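(* Let $k$ be an algebraically closed field of characteristic $0$ and let $\mathcal{C}$ be a self-dual fusion category of rank $4$ over $k$. Assume that $\mathrm{Irr}(\mathcal{C})=\{\mathbf{1},g,X,Y\}$ and that $\{\mathbf{1},g\}$ generates $\mathcal{C}_{pt}$. If the action of $g\otimes-$ on the set $\mathrm{Irr}(\mathcal{C})\setminus G(\mathcal{C})=\{X,Y\}$ has a fixed point, then the fusion rules of $\mathcal{C}$ are determined by non-negative integers $m,n,s,t$ as follows: $$g\otimes g=\mathbf{1},\quad g\otimes X=X,\quad g\otimes Y=Y,\quad Y\otimes X=nX\oplus sY,$$ $$X\otimes X=\mathbf{1}\oplus g\oplus mX\oplus nY,\quad Y\otimes Y=\mathbf{1}\oplus g\oplus sX\oplus tY.$$ Moreover, $m,n,s,t$ satisfy the relation $$n^2+s^2=2+ms+nt.$$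
   Context: A fusion category over $k$ is a $k$-linear semisimple rigid tensor category with finitely many isomorphism classes of simple objects, finite-dimensional morphism spaces, and simple unit object $\mathbf{1}$. $\mathrm{Irr}(\mathcal{C})$ is the set of isomorphism classes of simple objects; the rank of $\mathcal{C}$ is $|\mathrm{Irr}(\mathcal{C})|$. $\mathcal{C}$ is self-dual if $V^*\cong V$ for every simple object $V$; then the Grothendieck ring is commutative. The fusion rules are the decompositions $V\otimes W\cong\bigoplus_{U\in\mathrm{Irr}(\mathcal{C})}N_{VW}^{U}\,U$ of tensor products of simple objects, and equalities such as $g\otimes X=X$ mean isomorphism. $mX$ denotes the direct sum of $m$ copies of $X$. Products of simple objects not listed are determined by commutativity and by the unit. $G(\mathcal{C})$ is the group of isomorphism classes of invertible simple objects, and $\mathcal{C}_{pt}$ is the fusion subcategory generated by all invertible simple objects; the hypothesis that $\{\mathbf{1},g\}$ generates $\mathcal{C}_{pt}$ means that $\mathbf{1}$ and $g$ are exactly the invertible simple objects, i.e. $G(\mathcal{C})=\{\mathbf{1},g\}$. *)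

(* Defs.v *)
From HB Require Import structures.
From mathcomp Require Import all_boot all_order all_algebra.

Set Implicit Arguments.
Unset Strict Implicit.
Unset Printing Implicit Defensive.

Import GRing.Theory.
Local Open Scope ring_scope.

Declare Scope cat_scope.
Delimit Scope cat_scope with cat.
Open Scope cat_scope.

Reserved Notation "g ∘ f" (at level 40, left associativity).
Reserved Notation "X ≅ Y" (at level 70, no associativity).
Reserved Notation "X ⊕ Y" (at level 50, left associativity).
Reserved Notation "X ⊗ Y" (at level 40, left associativity).
Reserved Notation "f ⊗m g" (at level 40, left associativity).
Reserved Notation "m · X" (at level 40, left associativity).

(* k-linear categories; since [hom X Y] is a [vectType k], morphism spaces are
   finite-dimensional. *)
Record linearCategory (k : fieldType) := LinearCategory {
  obj :> Type;
  hom : obj -> obj -> vectType k;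
  idm : forall X, hom X X;
  comp : forall X Y Z, hom Y Z -> hom X Y -> hom X Z
    where "g ∘ f" := (comp g f);
  compA : forall X Y Z T (h : hom Z T) (g : hom Y Z) (f : hom X Y),
    h ∘ (g ∘ f) = (h ∘ g) ∘ f;
  comp1m : forall X Y (f : hom X Y), idm Y ∘ f = f;
  compm1 : forall X Y (f : hom X Y), f ∘ idm X = f;
  comp_linearl : forall X Y Z (a : k) (g g' : hom Y Z) (f : hom X Y),
    (a *: g + g') ∘ f = a *: (g ∘ f) + g' ∘ f;
  comp_linearr : forall X Y Z (a : k) (g : hom Y Z) (f f' : hom X Y),
    g ∘ (a *: f + f') = a *: (g ∘ f) + g ∘ f'
}.

Arguments hom {k l} X Y.
Arguments idm {k l} X.
Arguments comp {k l X Y Z} g f.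
Notation "g ∘ f" := (comp g f) : cat_scope.

Record iso (k : fieldType) (C : linearCategory k) (X Y : C) := Iso {
  iso_fun : hom X Y;
  iso_inv : hom Y X;
  iso_invK : iso_inv ∘ iso_fun = idm X;
  iso_funK : iso_fun ∘ iso_inv = idm Y
}.

Definition isomorphic (k : fieldType) (C : linearCategory k) (X Y : C) : Prop :=
  inhabited (iso X Y).
Notation "X ≅ Y" := (isomorphic X Y) : cat_scope.

Section LinearCategoryTheory.
Variables (k : fieldType) (C : linearCategory k).
Implicit Types X Y Z K Q S T : C.

Definition is_iso X Y (f : hom X Y) : Prop :=
  exists h : hom Y X, h ∘ f = idm X /\ f ∘ h = idm Y.

Definition monic X Y (f : hom X Y) : Prop :=
  forall T (u v : hom T X), f ∘ u = f ∘ v -> u = v.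

Definition epic X Y (f : hom X Y) : Prop :=
  forall T (u v : hom Y T), u ∘ f = v ∘ f -> u = v.

Definition zero_object Z : Prop :=
  forall X, (forall f : hom X Z, f = 0) /\ (forall f : hom Z X, f = 0).

Definition is_kernel X Y (f : hom X Y) K (i : hom K X) : Prop :=
  f ∘ i = 0 /\
  forall T (h : hom T X), f ∘ h = 0 -> exists! u : hom T K, i ∘ u = h.

Definition is_cokernel X Y (f : hom X Y) Q (p : hom Y Q) : Prop :=
  p ∘ f = 0 /\
  forall T (h : hom Y T), h ∘ f = 0 -> exists! u : hom Q T, u ∘ p = h.

Definition simple S : Prop :=
  ~ zero_object S /\
  forall T (i : hom T S), monic i -> zero_object T \/ is_iso i.

Record biproduct X Y S := Biproduct {
  bi_inl : hom X S;
  bi_inr : hom Y S;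
  bi_fst : hom S X;
  bi_snd : hom S Y;
  bi_fst_inl : bi_fst ∘ bi_inl = idm X;
  bi_snd_inr : bi_snd ∘ bi_inr = idm Y;
  bi_fst_inr : bi_fst ∘ bi_inr = 0;
  bi_snd_inl : bi_snd ∘ bi_inl = 0;
  bi_sum : bi_inl ∘ bi_fst + bi_inr ∘ bi_snd = idm S
}.

(* [t] lists each isomorphism class of simple objects exactly once. *)
Definition enumerates_Irr n (t : n.-tuple C) : Prop :=
  [/\ forall i, simple (tnth t i),
      forall i j, tnth t i ≅ tnth t j -> i = j
    & forall S, simple S -> exists i, S ≅ tnth t i].

Definition has_rank n : Prop := exists t : n.-tuple C, enumerates_Irr t.

Definition finitely_many_simples : Prop := exists n, has_rank n.

End LinearCategoryTheory.

Record additiveCategory (k : fieldType) := AdditiveCategory {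
  add_cat :> linearCategory k;
  zobj : add_cat;
  zobjP : zero_object zobj;
  dsum : add_cat -> add_cat -> add_cat;
  dsumP : forall X Y, biproduct X Y (dsum X Y)
}.

Arguments zobj {k a}.
Arguments dsum {k a} X Y.
Notation "X ⊕ Y" := (dsum X Y) : cat_scope.
Notation "m · X" := (\big[dsum/zobj]_(i < m) X) : cat_scope.

Record abelian (k : fieldType) (C : additiveCategory k) : Prop := Abelian {
  has_kernels : forall (X Y : C) (f : hom X Y),
    exists (K : C) (i : hom K X), is_kernel f i;
  has_cokernels : forall (X Y : C) (f : hom X Y),
    exists (Q : C) (p : hom Y Q), is_cokernel f p;
  monic_is_kernel : forall (X Y : C) (f : hom X Y), monic f ->
    exists (Z : C) (h : hom Y Z), is_kernel h f;
  epic_is_cokernel : forall (X Y : C) (f : hom X Y), epic f ->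
    exists (Z : C) (h : hom Z X), is_cokernel h f
}.

Definition semisimple (k : fieldType) (C : additiveCategory k) : Prop :=
  abelian C /\
  forall X : C, exists (n : nat) (F : 'I_n -> C),
    (forall i, simple (F i)) /\ X ≅ \big[dsum/zobj]_(i < n) F i.

Record tensorCategory (k : fieldType) := TensorCategory {
  tens_cat :> additiveCategory k;
  tensor : tens_cat -> tens_cat -> tens_cat
    where "X ⊗ Y" := (tensor X Y);
  tensorm : forall X X' Y Y' : tens_cat,
    hom X X' -> hom Y Y' -> hom (X ⊗ Y) (X' ⊗ Y')
    where "f ⊗m g" := (tensorm f g);
  tensorm_id : forall X Y : tens_cat, idm X ⊗m idm Y = idm (X ⊗ Y);
  tensorm_comp : forall (X X' X'' Y Y' Y'' : tens_cat)
      (f' : hom X' X'') (f : hom X X') (g' : hom Y' Y'') (g : hom Y Y'),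
    (f' ∘ f) ⊗m (g' ∘ g) = (f' ⊗m g') ∘ (f ⊗m g);
  tensorm_linearl : forall (X X' Y Y' : tens_cat) (a : k)
      (f f' : hom X X') (g : hom Y Y'),
    (a *: f + f') ⊗m g = a *: (f ⊗m g) + f' ⊗m g;
  tensorm_linearr : forall (X X' Y Y' : tens_cat) (a : k)
      (f : hom X X') (g g' : hom Y Y'),
    f ⊗m (a *: g + g') = a *: (f ⊗m g) + f ⊗m g';
  tunit : tens_cat where "\1" := tunit;
  assoc : forall X Y Z : tens_cat, iso (X ⊗ Y ⊗ Z) (X ⊗ (Y ⊗ Z));
  lunit : forall X : tens_cat, iso (\1 ⊗ X) X;
  runit : forall X : tens_cat, iso (X ⊗ \1) X;
  assoc_natural : forall (X X' Y Y' Z Z' : tens_cat)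
      (f : hom X X') (g : hom Y Y') (h : hom Z Z'),
    iso_fun (assoc X' Y' Z') ∘ ((f ⊗m g) ⊗m h)
      = (f ⊗m (g ⊗m h)) ∘ iso_fun (assoc X Y Z);
  lunit_natural : forall (X X' : tens_cat) (f : hom X X'),
    iso_fun (lunit X') ∘ (idm \1 ⊗m f) = f ∘ iso_fun (lunit X);
  runit_natural : forall (X X' : tens_cat) (f : hom X X'),
    iso_fun (runit X') ∘ (f ⊗m idm \1) = f ∘ iso_fun (runit X);
  pentagon : forall W X Y Z : tens_cat,
    iso_fun (assoc W X (Y ⊗ Z)) ∘ iso_fun (assoc (W ⊗ X) Y Z)
      = (idm W ⊗m iso_fun (assoc X Y Z)) ∘ iso_fun (assoc W (X ⊗ Y) Z)
          ∘ (iso_fun (assoc W X Y) ⊗m idm Z);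
  triangle : forall X Y : tens_cat,
    (idm X ⊗m iso_fun (lunit Y)) ∘ iso_fun (assoc X \1 Y)
      = iso_fun (runit X) ⊗m idm Y
}.

Arguments tensor {k t} X Y.
Arguments tensorm {k t X X' Y Y'} f g.
Arguments tunit {k t}.
Arguments assoc {k t} X Y Z.
Arguments lunit {k t} X.
Arguments runit {k t} X.
Notation "X ⊗ Y" := (tensor X Y) : cat_scope.
Notation "f ⊗m g" := (tensorm f g) : cat_scope.
Notation "\1" := tunit : cat_scope.

(* [A] is a left dual of [X], equivalently [X] is a right dual of [A]. The
   zigzag identities are usually stated as equalities with an identity; here
   the unit isomorphisms on the source are moved to the right-hand side. *)
Record duality (k : fieldType) (C : tensorCategory k) (A X : C) := Duality {
  ev : hom (A ⊗ X) \1;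
  coev : hom \1 (X ⊗ A);
  zigzag_r :
    iso_fun (runit X) ∘ (idm X ⊗m ev) ∘ iso_fun (assoc X A X)
      ∘ (coev ⊗m idm X) = iso_fun (lunit X);
  zigzag_l :
    iso_fun (lunit A) ∘ (ev ⊗m idm A) ∘ iso_inv (assoc A X A)
      ∘ (idm A ⊗m coev) = iso_fun (runit A)
}.

Record rigidCategory (k : fieldType) := RigidCategory {
  rigid_cat :> tensorCategory k;
  ldual : rigid_cat -> rigid_cat;
  rdual : rigid_cat -> rigid_cat;
  ldualP : forall X, duality (ldual X) X;
  rdualP : forall X, duality X (rdual X)
}.

Record fusionCategory (k : fieldType) := FusionCategory {
  fus_cat :> rigidCategory k;
  fus_semisimple : semisimple fus_cat;
  fus_finite : finitely_many_simples fus_cat;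
  fus_simple1 : simple (\1 : fus_cat)
}.

Definition self_dual (k : fieldType) (C : fusionCategory k) : Prop :=
  forall V : C, simple V -> ldual V ≅ V.

Definition invertible (k : fieldType) (C : tensorCategory k) (V : C) : Prop :=
  exists W : C, V ⊗ W ≅ \1 /\ W ⊗ V ≅ \1.

(* Main.v *)
Require Import Defs.
From HB Require Import structures.
From mathcomp Require Import all_boot all_order all_algebra.
From mathcomp Require Import zify.

Set Implicit Arguments.
Unset Strict Implicit.
Unset Printing Implicit Defensive.

Import GRing.Theory.
Import Defs.

(** The statement is a computation in the Grothendieck ring, so the work is to
reach that ring from the categorical axioms and then to exploit its symmetry.

Over an algebraically closed field the simple objects are orthonormal for the
form [hdim V W], the dimension of [hom V W] (Schur's lemma, [hdim_irr]). By
semisimplicity an object is then determined up to isomorphism by its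
multiplicities [hdim 't_i V] ([isomorphic_hdim]), and every nat-valued function
of objects that is additive on biproducts is the combination of its values at
simple objects weighted by these multiplicities ([additive_function_irr]). Hence
the associator turns into the associativity identity for the structure constants
[N a b c], the multiplicity of [t_c] in the product of [t_a] and [t_b]
([fusion_coef_assoc]).

Duality enters through one inequality. If [A] is a left dual of [X], transposing
morphisms along the coevaluation embeds [hom (A ⊗ V) W] into [hom V (X ⊗ W)]
([hdim_duality_le]). For self-dual simple objects this reads
[N a b c <= N a c b], and exchanging [b] and [c] makes it an equality. Comparing
multiplicities of the unit in both bracketings of a triple product shows
that [N] is also invariant under cyclic permutations ([fusion_coef_cycle]), so
[N] is a symmetric function of its three arguments; in particular the
Grothendieck ring is commutative.

In rank 4, an invertible simple [g] squares to the unit ([invertible_square]), so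
[N g] restricted to the span of [X] and [Y] is a symmetric nonnegative integer
matrix of square 1; a fixed point forces it to be the identity. With
[m = N X X X], [n = N X X Y], [s = N X Y Y], [t = N Y Y Y], symmetry gives all the
fusion rules, and the multiplicity of [Y] in [X ⊗ X ⊗ Y], computed with both
bracketings, gives the quadratic relation. *)

(** * Linear algebra *)

Lemma linear_inj_dim (k : fieldType) (U V : vectType k) (f : U -> V) :
  linear f -> injective f -> dim U <= dim V.
Proof.
move=> f_lin f_inj.
pose F : {linear U -> V} := HB.pack f (GRing.isLinear.Build k U V _ f f_lin).
have F_inj : lker (linfun F) == 0%VS.
  by apply/lker0P => x y; rewrite !lfunE => /f_inj.
rewrite -(dimvf U) -(@limg_dim_eq _ _ _ (linfun F)); first exact/rank_leq_col.
by rewrite (eqP F_inj) capv0.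
Qed.

(** The characteristic polynomial of [f] has positive degree, hence a root. *)
Lemma linear_eigenvector (k : closedFieldType) (U : vectType k) (f : U -> U) :
  linear f -> 0 < dim U -> exists a u, u != 0%R /\ f u = (a *: u)%R.
Proof.
move=> f_lin U_gt0.
pose F : {linear U -> U} := HB.pack f (GRing.isLinear.Build k U U _ f f_lin).
have basisU := vbasisP {:U}.
pose M := passmx.mxof (vbasis {:U}) (vbasis {:U}) (linfun F).
have /closed_rootP[a] : size (char_poly M) != 1.
  by rewrite size_char_poly eqSS -lt0n dimvf.
rewrite -eigenvalue_root_char /eigenvalue => nz_eig.
have : passmx.leigenspace (linfun F) a != 0%VS.
  by rewrite (passmx.leigenspaceE basisU) passmx.vsof_eq0.
rewrite -vpick0; set u := vpick _ => u_neq0; exists a, u; split => //.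
have: u \in passmx.leigenspace (linfun F) a by exact: memv_pick.
by rewrite memv_ker !lfun_simp subr_eq0 => /eqP.
Qed.

(** * Linear categories: dimensions of morphism spaces *)

Section LinearCategory.
Variables (k : fieldType) (C : linearCategory k).
Implicit Types X Y Z V W S T : C.
Local Open Scope ring_scope.

Lemma compDl X Y Z (g g' : hom Y Z) (f : hom X Y) :
  (g + g') ∘ f = g ∘ f + g' ∘ f.
Proof. by have := comp_linearl 1 g g' f; rewrite !scale1r. Qed.

Lemma compDr X Y Z (g : hom Y Z) (f f' : hom X Y) :
  g ∘ (f + f') = g ∘ f + g ∘ f'.
Proof. by have := comp_linearr 1 g f f'; rewrite !scale1r. Qed.

Lemma comp0m X Y Z (f : hom X Y) : (0 : hom Y Z) ∘ f = 0.
Proof. by apply: (addrI (0 ∘ f)); rewrite -compDl !addr0. Qed.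

Lemma compm0 X Y Z (g : hom Y Z) : g ∘ (0 : hom X Y) = 0.
Proof. by apply: (addrI (g ∘ 0)); rewrite -compDr !addr0. Qed.

Lemma compBl X Y Z (g g' : hom Y Z) (f : hom X Y) :
  (g - g') ∘ f = g ∘ f - g' ∘ f.
Proof. by apply/eqP; rewrite eq_sym subr_eq -compDl subrK. Qed.

Lemma compBr X Y Z (g : hom Y Z) (f f' : hom X Y) :
  g ∘ (f - f') = g ∘ f - g ∘ f'.
Proof. by apply/eqP; rewrite eq_sym subr_eq -compDr subrK. Qed.

Lemma compZl X Y Z (a : k) (g : hom Y Z) (f : hom X Y) :
  (a *: g) ∘ f = a *: (g ∘ f).
Proof. by have := comp_linearl a g 0 f; rewrite comp0m !addr0. Qed.

Lemma isomorphic_refl X : X ≅ X.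
Proof. by constructor; exists (idm X) (idm X); rewrite comp1m. Qed.

Lemma isomorphic_sym X Y : X ≅ Y -> Y ≅ X.
Proof. by case=> -[f f' ff' f'f]; constructor; exists f' f. Qed.

Lemma isomorphic_trans Y X Z : X ≅ Y -> Y ≅ Z -> X ≅ Z.
Proof.
case=> -[f f' ff' f'f] [[g g' gg' g'g]]; constructor.
exists (g ∘ f) (f' ∘ g').
  by rewrite compA -(compA f') gg' compm1.
by rewrite compA -(compA g) f'f compm1.
Qed.

Lemma iso_fun_epic X Y (i : iso X Y) Z (u v : hom Y Z) :
  u ∘ iso_fun i = v ∘ iso_fun i -> u = v.
Proof.
move=> /(congr1 (comp^~ (iso_inv i))).
by rewrite -!compA iso_funK !compm1.
Qed.

Lemma iso_inv_epic X Y (i : iso X Y) Z (u v : hom X Z) :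
  u ∘ iso_inv i = v ∘ iso_inv i -> u = v.
Proof.
move=> /(congr1 (comp^~ (iso_fun i))).
by rewrite -!compA iso_invK !compm1.
Qed.

Definition hdim V W : nat := dim (hom V W).

Lemma hdim_iso V V' W W' : V ≅ V' -> W ≅ W' -> hdim V W = hdim V' W'.
Proof.
have le V1 V2 W1 W2 : V1 ≅ V2 -> W1 ≅ W2 -> (hdim V1 W1 <= hdim V2 W2)%N.
  case=> -[f f' ff' f'f] [[g g' gg' g'g]].
  apply: (@linear_inj_dim _ _ _ (fun u : hom V1 W1 => g ∘ u ∘ f')).
    by move=> a u v; rewrite comp_linearr comp_linearl.
  move=> u v /(congr1 (fun w => g' ∘ w ∘ f)).
  by rewrite !compA gg' !comp1m -!compA ff' !compm1.
by move=> VV' WW'; apply/eqP; rewrite eqn_leq !le //; exact: isomorphic_sym.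
Qed.

Lemma hdim_gt0P V W : reflect (exists f : hom V W, f <> 0) (0 < hdim V W)%N.
Proof.
rewrite /hdim -dimvf lt0n dimv_eq0; apply: (iffP idP) => [nz|[f nz]].
  by exists (vpick {:hom V W}); apply/eqP; rewrite vpick0.
by apply/eqP => full0; have := memvf f; rewrite full0 memv0 => /eqP.
Qed.

(** Being a zero object thus passes through any functor that preserves
identities and zero morphisms, such as tensoring with a fixed object. *)
Lemma zero_objectP Z : zero_object Z <-> idm Z = 0.
Proof.
split=> [zZ | id0 X]; first by rewrite (proj1 (zZ Z) (idm Z)).
by split=> f; [rewrite -(comp1m f) | rewrite -(compm1 f)];
  rewrite id0 (comp0m, compm0).
Qed.

Lemma hdim_zero_objectr Z V : zero_object Z -> hdim V Z = 0%N.
Proof. by move=> zZ; apply/eqP/contraT; rewrite -lt0n=> /hdim_gt0P[f []]; case: (zZ V). Qed.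

Lemma hdim_zero_objectl Z V : zero_object Z -> hdim Z V = 0%N.
Proof. by move=> zZ; apply/eqP/contraT; rewrite -lt0n=> /hdim_gt0P[f []]; case: (zZ V). Qed.

(** A morphism into a biproduct is the same as a pair of morphisms into its
summands: the two inequalities come from the projections and the injections. *)
Lemma hdim_biproductr X Y S : biproduct X Y S ->
  forall V, hdim V S = (hdim V X + hdim V Y)%N.
Proof.
case=> i j p q pi qj pj qi e V.
have dimP : dim (hom V X * hom V Y)%type = (hdim V X + hdim V Y)%N by [].
apply/eqP; rewrite eqn_leq -dimP; apply/andP; split.
  apply: (@linear_inj_dim _ _ _ (fun u => (p ∘ u, q ∘ u))).
    by move=> a u v; rewrite !comp_linearr.
  move=> u v [pu qu]; rewrite -[u]comp1m -[v]comp1m -e !compDl -!compA.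
  by rewrite pu qu.
apply: (@linear_inj_dim _ _ _
  (fun uv : hom V X * hom V Y => i ∘ uv.1 + j ∘ uv.2)).
  move=> a u v /=; rewrite !comp_linearr scalerDr.
  by rewrite !addrA; congr (_ + _); rewrite addrAC.
move=> [u u'] [v v'] /= eq_uv; congr pair.
  have := congr1 (comp p) eq_uv.
  by rewrite !compDr !compA pi pj !comp1m !comp0m !addr0.
have := congr1 (comp q) eq_uv.
by rewrite !compDr !compA qi qj !comp1m !comp0m !add0r.
Qed.

Lemma hdim_biproductl X Y S : biproduct X Y S ->
  forall V, hdim S V = (hdim X V + hdim Y V)%N.
Proof.
case=> i j p q pi qj pj qi e V.
have dimP : dim (hom X V * hom Y V)%type = (hdim X V + hdim Y V)%N by [].
apply/eqP; rewrite eqn_leq -dimP; apply/andP; split.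
  apply: (@linear_inj_dim _ _ _ (fun u => (u ∘ i, u ∘ j))).
    by move=> a u v; rewrite !comp_linearl.
  move=> u v [pu qu]; rewrite -[u]compm1 -[v]compm1 -e !compDr !compA.
  by rewrite pu qu.
apply: (@linear_inj_dim _ _ _
  (fun uv : hom X V * hom Y V => uv.1 ∘ p + uv.2 ∘ q)).
  move=> a u v /=; rewrite !comp_linearl scalerDr.
  by rewrite !addrA; congr (_ + _); rewrite addrAC.
move=> [u u'] [v v'] /= eq_uv; congr pair.
  have := congr1 (comp^~ i) eq_uv.
  by rewrite !compDl -!compA pi qi !compm1 !compm0 !addr0.
have := congr1 (comp^~ j) eq_uv.
by rewrite !compDl -!compA pj qj !compm1 !compm0 !add0r.
Qed.

Lemma monic_ker0 X Y (f : hom X Y) :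
  (forall T (u : hom T X), f ∘ u = 0 -> u = 0) -> monic f.
Proof.
move=> f0 T u v fuv; apply/eqP; rewrite -subr_eq0; apply/eqP/f0.
by rewrite compBr fuv subrr.
Qed.

End LinearCategory.

(** * Direct sums *)

Section Additive.
Variables (k : fieldType) (C : additiveCategory k).
Implicit Types X Y Z V W S T : C.
Local Open Scope ring_scope.

Lemma dsum_iso X X' Y Y' : X ≅ X' -> Y ≅ Y' -> X ⊕ Y ≅ X' ⊕ Y'.
Proof.
case=> -[f f' ff' f'f] [[g g' gg' g'g]].
case: (dsumP X Y) => i j p q pi qj pj qi e.
case: (dsumP X' Y') => i' j' p' q' pi' qj' pj' qi' e'.
constructor; exists (i' ∘ f ∘ p + j' ∘ g ∘ q) (i ∘ f' ∘ p' + j ∘ g' ∘ q').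
  rewrite compDr !compDl -!compA !(compA p') !(compA q').
  rewrite pi' pj' qi' qj' !comp0m !compm0 addr0 add0r !comp1m.
  by rewrite (compA f') (compA g') ff' gg' !comp1m e.
rewrite compDr !compDl -!compA !(compA p) !(compA q).
rewrite pi pj qi qj !comp0m !compm0 addr0 add0r !comp1m.
by rewrite (compA f) (compA g) f'f g'g !comp1m e'.
Qed.

(** In terms of components, [(x, (y, z))] is sent to [(y, (x, z))]. *)
Definition swap_fun X Y Z : hom (X ⊕ (Y ⊕ Z)) (Y ⊕ (X ⊕ Z)) :=
  let b1 := dsumP X (Y ⊕ Z) in let b2 := dsumP Y Z in
  let c1 := dsumP Y (X ⊕ Z) in let c2 := dsumP X Z in
  bi_inl c1 ∘ (bi_fst b2 ∘ bi_snd b1) +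
  bi_inr c1 ∘ (bi_inl c2 ∘ bi_fst b1 + bi_inr c2 ∘ (bi_snd b2 ∘ bi_snd b1)).

Lemma swap_funK X Y Z : swap_fun Y X Z ∘ swap_fun X Y Z = idm (X ⊕ (Y ⊕ Z)).
Proof.
rewrite /swap_fun.
case: (dsumP X (Y ⊕ Z)) => i1 j1 p1 q1 pi1 qj1 pj1 qi1 e1.
case: (dsumP Y Z) => i2 j2 p2 q2 pi2 qj2 pj2 qi2 e2.
case: (dsumP Y (X ⊕ Z)) => i3 j3 p3 q3 pi3 qj3 pj3 qi3 e3.
case: (dsumP X Z) => i4 j4 p4 q4 pi4 qj4 pj4 qi4 e4 /=.
set s := i3 ∘ _ + _.
have ps : p3 ∘ s = p2 ∘ q1.
  by rewrite compDr !(compA p3) pi3 pj3 comp0m addr0 comp1m.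
have qs : q3 ∘ s = i4 ∘ p1 + j4 ∘ (q2 ∘ q1).
  by rewrite compDr !(compA q3) qi3 qj3 comp0m add0r comp1m.
clearbody s; rewrite !(compDl, compDr) -!compA ps qs !compDr !(compA p4) !(compA q4).
rewrite pi4 qi4 pj4 qj4 !comp0m !comp1m !compm0 addr0 add0r.
by rewrite -compDr !(compA _ _ q1) -compDl e2 comp1m e1.
Qed.

Lemma dsum_swap X Y Z : X ⊕ (Y ⊕ Z) ≅ Y ⊕ (X ⊕ Z).
Proof. by constructor; exists (swap_fun X Y Z) (swap_fun Y X Z); exact: swap_funK. Qed.

(** Direct sums are commutative and associative only up to isomorphism, not up to
equality, so reordering a sum needs its own argument. Exchanging the two
leading terms ([dsum_swap]) is enough to bring any term to the front, and the
rest is an induction. *)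
Lemma dsum_perm (I : eqType) (t : I -> C) (s s' : seq I) : perm_eq s s' ->
  \big[dsum/zobj]_(i <- s) t i ≅ \big[dsum/zobj]_(i <- s') t i.
Proof.
elim: s s' => [|x s IHs] s' eq_ss'.
  by move: eq_ss'; rewrite perm_sym => /perm_nilP ->; exact: isomorphic_refl.
have /path.splitPr s'x : x \in s' by rewrite -(perm_mem eq_ss') mem_head.
case: s'x eq_ss' => a b; rewrite perm_sym perm_catC /= perm_cons => eq_bas.
have eq_sab : perm_eq s (a ++ b) by rewrite perm_sym perm_catC.
rewrite big_cons; apply: isomorphic_trans (dsum_iso (isomorphic_refl _) (IHs _ eq_sab)) _.
elim: a {eq_bas eq_sab} => [|y a IHa] /=; first by rewrite big_cons; exact: isomorphic_refl.
rewrite !big_cons; apply: isomorphic_trans (dsum_swap _ _ _) _.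
exact: dsum_iso (isomorphic_refl _) IHa.
Qed.

Lemma hdim_dsum Z V W : hdim Z (V ⊕ W) = (hdim Z V + hdim Z W)%N.
Proof. exact: hdim_biproductr (dsumP V W) Z. Qed.

Lemma hdim_big (I : Type) (r : seq I) (F : I -> C) Z :
  hdim Z (\big[dsum/zobj]_(i <- r) F i) = (\sum_(i <- r) hdim Z (F i))%N.
Proof.
apply: big_morph; first exact: hdim_dsum.
exact/hdim_zero_objectr/zobjP.
Qed.

Lemma hdim_muln m Z V : hdim Z (m · V) = (m * hdim Z V)%N.
Proof. by rewrite hdim_big sum_nat_const card_ord. Qed.

(** These are the functions that factor through the split Grothendieck group. *)
Definition additive_function (D : C -> nat) : Prop :=
  [/\ forall V W, V ≅ W -> D V = D W, forall Z, zero_object Z -> D Z = 0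
    & forall V W S, biproduct V W S -> D S = D V + D W].

End Additive.

(** * Schur's lemma and multiplicities in semisimple categories *)

(** The kernel of [f] is a subobject of [S], so it is zero or all of [S]; since
[f] is nonzero it is zero. Thus [f] is a monomorphism into the simple object
[T], from a nonzero source. *)
Lemma schur_iso (k : fieldType) (C : additiveCategory k) (abC : abelian C)
    (S T : C) (f : hom S T) :
  simple S -> simple T -> f <> 0%R -> is_iso f.
Proof.
move=> [nzS subS] [_ subT] f_neq0.
have [K [i [fi0 iP]]] := has_kernels abC f.
have i_mono : monic i.
  move=> V u v iuv; have [|w [_ w_uniq]] := iP V (i ∘ u).
    by rewrite compA fi0 comp0m.
  by rewrite -(w_uniq u) // (w_uniq v).
have [zK|[h [_ ih]]] := subS _ _ i_mono; last first.
  by case: f_neq0; rewrite -(compm1 f) -ih compA fi0 comp0m.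
have f_mono : monic f.
  apply: monic_ker0 => V u fu0; have [w [<- _]] := iP V u fu0.
  by rewrite (proj1 (zK V) w) compm0.
by case: (subT _ _ f_mono).
Qed.

Section Semisimple.
Variables (k : closedFieldType) (C : additiveCategory k).
Hypothesis ssC : semisimple C.
Implicit Types X Y Z V W S T : C.

(** An eigenvalue [a] of composition with [f] on the finite-dimensional algebra
[hom S S] makes [f - a] non-invertible, hence zero. *)
Lemma schur_scalar S (f : hom S S) :
  simple S -> exists a : k, f = (a *: idm S)%R.
Proof.
move=> simS; have [nzS _] := simS.
have id_neq0 : idm S <> 0%R by move/zero_objectP.
have [|a [u [u_neq0 fu]]] :=
  @linear_eigenvector _ (hom S S) (fun u => f ∘ u) (fun a => comp_linearr a f).
  by apply/hdim_gt0P; exists (idm S).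
exists a; apply/eqP; rewrite -subr_eq0; apply/negP => /negP/eqP f_neq.
have [h [hf _]] := schur_iso ssC.1 simS simS f_neq.
case/eqP: u_neq0; rewrite -(comp1m u) -hf -compA compBl fu compZl comp1m.
by rewrite subrr compm0.
Qed.

Lemma hdim_simple_self S : simple S -> hdim S S = 1.
Proof.
move=> simS; have [nzS _] := simS.
apply/eqP; rewrite eqn_leq; apply/andP; split; last first.
  by apply/hdim_gt0P; exists (idm S) => /zero_objectP.
rewrite /hdim -dimvf -[X in _ <= X]/(nat_of_bool true).
apply: leq_trans (_ : \dim <[idm S]>%VS <= _); last by rewrite dim_vline leq_b1.
apply/dimvS/subvP => f _; have [a ->] := schur_scalar f simS.
exact/memvZ/memv_line.
Qed.

Lemma hdim_simple_neq S T : simple S -> simple T -> ~ S ≅ T -> hdim S T = 0.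
Proof.
move=> simS simT nST; apply/eqP/contraT; rewrite -lt0n => /hdim_gt0P[f f_neq0].
have [h [hf fh]] := schur_iso ssC.1 simS simT f_neq0.
by case: nST; constructor; exists f h.
Qed.

Variables (n : nat) (t : n.-tuple C).
Hypothesis t_irr : enumerates_Irr t.
Local Notation "'t_ i" := (tnth t i) (at level 8, i at level 2, format "''t_' i").

Lemma hdim_irr i j : hdim 't_i 't_j = (i == j).
Proof.
have [sim t_inj _] := t_irr; case: eqVneq => [->|/eqP ij].
  exact: hdim_simple_self.
by apply: hdim_simple_neq => // /t_inj.
Qed.

(** Indexing the simple summands by a list of indices rather than by a family
of objects lets two decompositions be compared by permuting lists. *)
Lemma irr_decomposition V :
  exists s : seq 'I_n, V ≅ \big[dsum/zobj]_(i <- s) 't_i.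
Proof.
have [_ _ t_all] := t_irr; have [m [F [simF VF]]] := ssC.2 V.
have [sg sgP] := fin_all_exists (fun i => t_all _ (simF i)).
exists [seq sg i | i <- index_enum 'I_m]; rewrite big_map.
apply: isomorphic_trans VF _.
apply: (big_ind2 (@isomorphic _ _)) => [|????|i _]; [|exact: dsum_iso|exact: sgP].
exact: isomorphic_refl.
Qed.

Lemma hdim_irr_big s i :
  hdim 't_i (\big[dsum/zobj]_(j <- s) 't_j) = count_mem i s.
Proof.
rewrite hdim_big -sum1_count [RHS]big_mkcond; apply: eq_bigr => j _ /=.
by rewrite hdim_irr eq_sym; case: eqP.
Qed.

(** Equal multiplicities mean that the two lists of simple summands are
permutations of each other. *)
Lemma isomorphic_hdim V W :
  (forall i, hdim 't_i V = hdim 't_i W) -> V ≅ W.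
Proof.
have [s Vs] := irr_decomposition V; have [s' Ws'] := irr_decomposition W.
move=> eqVW; apply: (isomorphic_trans Vs).
apply: isomorphic_trans (isomorphic_sym Ws'); apply: dsum_perm.
apply/allP => i _ /=; rewrite -!hdim_irr_big; apply/eqP.
rewrite -(hdim_iso (isomorphic_refl _) Vs) eqVW.
exact: hdim_iso (isomorphic_refl _) Ws'.
Qed.

(** Both sides are additive in [V], and they agree at simple objects by
[hdim_irr]. *)
Lemma additive_function_irr D V : additive_function D ->
  D V = \sum_i hdim 't_i V * D 't_i.
Proof.
case=> Diso D0 Dadd; have [s Vs] := irr_decomposition V.
rewrite (Diso _ _ Vs).
under [RHS]eq_bigr do rewrite (hdim_iso (isomorphic_refl _) Vs).
elim: s {Vs} => [|j s IHs].
  rewrite big_nil D0; last exact: zobjP.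
  by rewrite big1 // => i _; rewrite hdim_zero_objectr //; exact: zobjP.
rewrite big_cons (Dadd _ _ _ (dsumP _ _)) IHs.
under [RHS]eq_bigr do rewrite hdim_dsum hdim_irr mulnDl.
rewrite big_split /=; congr (_ + _); rewrite (bigD1 j) //= eqxx mul1n.
by rewrite big1 ?addn0 // => i /negPf->.
Qed.

(** Both sides are additive in [V] and symmetric at simple objects. *)
Lemma hdim_irr_sym V i : hdim V 't_i = hdim 't_i V.
Proof.
rewrite (@additive_function_irr (fun W => hdim W 't_i)); last first.
  split=> [???|??|????]; [|exact: hdim_zero_objectl|exact: hdim_biproductl].
  exact/hdim_iso/isomorphic_refl.
rewrite (bigD1 i) //= big1 ?hdim_irr ?eqxx ?muln1 ?addn0 // => j /negPf ji.
by rewrite hdim_irr ji muln0.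
Qed.

End Semisimple.

(** * Tensor products and transposition along a duality *)

Section Tensor.
Variables (k : fieldType) (C : tensorCategory k).
Implicit Types X Y Z V W S T U : C.
Local Open Scope ring_scope.

Lemma tensormDl X X' Y Y' (f f' : hom X X') (g : hom Y Y') :
  (f + f') ⊗m g = f ⊗m g + f' ⊗m g.
Proof. by have := tensorm_linearl 1 f f' g; rewrite !scale1r. Qed.

Lemma tensormDr X X' Y Y' (f : hom X X') (g g' : hom Y Y') :
  f ⊗m (g + g') = f ⊗m g + f ⊗m g'.
Proof. by have := tensorm_linearr 1 f g g'; rewrite !scale1r. Qed.

Lemma tensor0m X X' Y Y' (g : hom Y Y') : (0 : hom X X') ⊗m g = 0.
Proof. by apply: (addrI (0 ⊗m g)); rewrite -tensormDl !addr0. Qed.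

Lemma tensorm0 X X' Y Y' (f : hom X X') : f ⊗m (0 : hom Y Y') = 0.
Proof. by apply: (addrI (f ⊗m 0)); rewrite -tensormDr !addr0. Qed.

Lemma tensor_iso X X' Y Y' : X ≅ X' -> Y ≅ Y' -> X ⊗ Y ≅ X' ⊗ Y'.
Proof.
case=> -[f f' ff' f'f] [[g g' gg' g'g]]; constructor.
by exists (f ⊗m g) (f' ⊗m g'); rewrite -tensorm_comp ?ff' ?gg' ?f'f ?g'g tensorm_id.
Qed.

Lemma hdim_tensorl_additive Z W :
  additive_function (fun V => hdim Z (V ⊗ W)).
Proof.
split=> [V V' VV'|V zV|V V' S [i j p q pi qj pj qi e]].
- exact: hdim_iso (isomorphic_refl _) (tensor_iso VV' (isomorphic_refl _)).
- apply/hdim_zero_objectr/zero_objectP.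
  by rewrite -tensorm_id (proj1 (zero_objectP _) zV) tensor0m.
apply: hdim_biproductr.
by exists (i ⊗m idm W) (j ⊗m idm W) (p ⊗m idm W) (q ⊗m idm W);
  rewrite -!tensorm_comp ?comp1m ?pi ?qj ?pj ?qi ?tensorm_id ?tensor0m //
     -tensormDl e tensorm_id.
Qed.

Lemma hdim_tensorr_additive Z W :
  additive_function (fun V => hdim Z (W ⊗ V)).
Proof.
split=> [V V' VV'|V zV|V V' S [i j p q pi qj pj qi e]].
- exact: hdim_iso (isomorphic_refl _) (tensor_iso (isomorphic_refl _) VV').
- apply/hdim_zero_objectr/zero_objectP.
  by rewrite -tensorm_id (proj1 (zero_objectP _) zV) tensorm0.
apply: hdim_biproductr.
by exists (idm W ⊗m i) (idm W ⊗m j) (idm W ⊗m p) (idm W ⊗m q);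
  rewrite -!tensorm_comp ?comp1m ?pi ?qj ?pj ?qi ?tensorm_id ?tensorm0 //
     -tensormDr e tensorm_id.
Qed.

Lemma tensorm_compr A X Y Z (g : hom Y Z) (f : hom X Y) :
  idm A ⊗m (g ∘ f) = (idm A ⊗m g) ∘ (idm A ⊗m f).
Proof. by rewrite -tensorm_comp comp1m. Qed.

(** The transpose of [f] along the coevaluation. Its source is [\1 ⊗ V]
instead of [V] so that no unit isomorphism has to be inserted. *)
Definition adjunct A X (d : duality A X) V W (f : hom (A ⊗ V) W) :
    hom (\1 ⊗ V) (X ⊗ W) :=
  (idm X ⊗m f) ∘ iso_fun (assoc X A V) ∘ (coev d ⊗m idm V).

Definition unadjunct A X (d : duality A X) U W (h : hom U (X ⊗ W)) :
    hom (A ⊗ U) W :=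
  iso_fun (lunit W) ∘ (ev d ⊗m idm W) ∘ iso_inv (assoc A X W) ∘ (idm A ⊗m h).

Lemma assoc_inv_natural X X' Y Y' Z Z'
    (f : hom X X') (g : hom Y Y') (h : hom Z Z') :
  iso_inv (assoc X' Y' Z') ∘ (f ⊗m (g ⊗m h))
    = ((f ⊗m g) ⊗m h) ∘ iso_inv (assoc X Y Z).
Proof.
apply: (iso_fun_epic (i := assoc X Y Z)).
rewrite -!compA -assoc_natural iso_invK compm1.
by rewrite compA iso_invK comp1m.
Qed.

(** The pentagon with the associators that have to be inverted moved across,
in the form needed to cancel [adjunct] against [unadjunct]. *)
Lemma assoc_inv_pentagon W X Y Z :
  iso_inv (assoc W X (Y ⊗ Z)) ∘ (idm W ⊗m iso_fun (assoc X Y Z))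
      ∘ iso_fun (assoc W (X ⊗ Y) Z)
  = iso_fun (assoc (W ⊗ X) Y Z) ∘ (iso_inv (assoc W X Y) ⊗m idm Z).
Proof.
have e : (iso_inv (assoc W X Y) ⊗m idm Z) ∘ (iso_fun (assoc W X Y) ⊗m idm Z)
         = idm _ by rewrite -tensorm_comp iso_invK comp1m tensorm_id.
have e' : (iso_fun (assoc W X Y) ⊗m idm Z) ∘ (iso_inv (assoc W X Y) ⊗m idm Z)
         = idm _ by rewrite -tensorm_comp iso_funK comp1m tensorm_id.
pose a : iso _ _ := Iso e e'.
apply: (iso_fun_epic (i := a)); rewrite /= -!compA e compm1.
by rewrite (compA (idm W ⊗m _)) -pentagon compA iso_invK comp1m.
Qed.

(** Naturality moves [f] out to the left, the pentagon regroups the remaining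
associators, and the zigzag identity evaluates what is left. In a strict category
the second factor would be the identity; here it is a composite of structural
isomorphisms, which need not be simplified to see that it is invertible. *)
Lemma unadjunctK A X (d : duality A X) V W (f : hom (A ⊗ V) W) :
  unadjunct d (adjunct d f) =
  f ∘ (iso_fun (lunit (A ⊗ V)) ∘ iso_fun (assoc \1 A V)
       ∘ ((iso_inv (lunit A) ∘ iso_fun (runit A)) ⊗m idm V)
       ∘ iso_inv (assoc A \1 V)).
Proof.
(* The zigzag identity as a statement about the evaluation and coevaluation
   alone, so that it can be tensored with [V]. *)
have zigzag : (ev d ⊗m idm A) ∘ (iso_inv (assoc A X A) ∘ (idm A ⊗m coev d))
    = iso_inv (lunit A) ∘ iso_fun (runit A).
  by rewrite -(zigzag_l d) !compA iso_invK comp1m.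
have f_out : iso_fun (lunit W) ∘ (ev d ⊗m idm W) ∘ (idm (A ⊗ X) ⊗m f)
    = f ∘ (iso_fun (lunit (A ⊗ V)) ∘ (ev d ⊗m idm (A ⊗ V))).
  rewrite (compA f) -lunit_natural -!compA -!tensorm_comp.
  by rewrite !comp1m !compm1.
have coev_out : idm A ⊗m (coev d ⊗m idm V)
    = iso_fun (assoc A (X ⊗ A) V) ∘ ((idm A ⊗m coev d) ⊗m idm V)
        ∘ iso_inv (assoc A \1 V).
  by rewrite assoc_natural -compA iso_funK compm1.
rewrite /unadjunct /adjunct !tensorm_compr coev_out !compA.
rewrite -(compA _ (iso_inv _)) assoc_inv_natural tensorm_id !compA f_out.
rewrite -!compA; congr (_ ∘ (_ ∘ _)); rewrite !compA; congr (_ ∘ _).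
rewrite -(compA (ev d ⊗m _)) -(compA _ _ (iso_fun (assoc _ _ V))).
rewrite assoc_inv_pentagon compA -tensorm_id -assoc_natural -!compA.
by congr (_ ∘ _); rewrite -!tensorm_comp !comp1m zigzag.
Qed.

(** By [unadjunctK], [adjunct d f] determines the precomposition of [f] with
isomorphisms, which are cancelled one at a time. *)
Lemma adjunct_inj A X (d : duality A X) V W : injective (@adjunct A X d V W).
Proof.
move=> f f' /(congr1 (@unadjunct A X d _ _)); rewrite !unadjunctK !compA.
move=> /iso_inv_epic.
pose b := (iso_inv (lunit A) ∘ iso_fun (runit A)) ⊗m idm V.
pose b' := (iso_inv (runit A) ∘ iso_fun (lunit A)) ⊗m idm V.
have bK : b' ∘ b = idm _.
  rewrite -tensorm_comp comp1m compA -(compA _ _ (iso_inv _)) iso_funK compm1.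
  by rewrite iso_invK tensorm_id.
have b'K : b ∘ b' = idm _.
  rewrite -tensorm_comp comp1m compA -(compA _ _ (iso_inv _)) iso_funK compm1.
  by rewrite iso_invK tensorm_id.
by move=> /(iso_fun_epic (i := Iso bK b'K)) /iso_fun_epic /iso_fun_epic.
Qed.

Lemma hdim_duality_le A X V W :
  duality A X -> (hdim (A ⊗ V) W <= hdim V (X ⊗ W))%N.
Proof.
move=> d; have V1 : \1 ⊗ V ≅ V by constructor; exact: lunit.
rewrite -(hdim_iso V1 (isomorphic_refl _)).
apply: (@linear_inj_dim _ _ _ _ _ (@adjunct_inj _ _ d V W)) => a f f'.
by rewrite /adjunct tensorm_linearr !comp_linearl.
Qed.

End Tensor.

(** * Structure constants of the Grothendieck ring *)

Section FusionRules.
Variables (k : closedFieldType) (C : fusionCategory k).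
Hypothesis C_self_dual : self_dual C.
Variables (n : nat) (t : n.-tuple C) (u : 'I_n).
Hypotheses (t_irr : enumerates_Irr t) (t_unit : tnth t u = \1).
Local Notation "'t_ i" := (tnth t i) (at level 8, i at level 2, format "''t_' i").

Definition fusion_coef (a b c : 'I_n) : nat := hdim 't_c ('t_a ⊗ 't_b).
Local Notation N := fusion_coef.

Lemma hdim_tensorl Z V W :
  hdim Z (V ⊗ W) = \sum_e hdim 't_e V * hdim Z ('t_e ⊗ W).
Proof.
exact: (additive_function_irr (fus_semisimple C) t_irr V
  (hdim_tensorl_additive Z W)).
Qed.

Lemma hdim_tensorr Z V W :
  hdim Z (W ⊗ V) = \sum_e hdim 't_e V * hdim Z (W ⊗ 't_e).
Proof.
exact: (additive_function_irr (fus_semisimple C) t_irr V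
  (hdim_tensorr_additive Z W)).
Qed.

Lemma fusion_coef_unitl b c : N u b c = (b == c).
Proof.
rewrite /fusion_coef t_unit eq_sym -(hdim_irr (fus_semisimple C) t_irr).
apply: hdim_iso (isomorphic_refl _) _; constructor; exact: lunit.
Qed.

Lemma fusion_coef_unitr a c : N a u c = (a == c).
Proof.
rewrite /fusion_coef t_unit eq_sym -(hdim_irr (fus_semisimple C) t_irr).
apply: hdim_iso (isomorphic_refl _) _; constructor; exact: runit.
Qed.

Lemma fusion_coef_assoc a b c d :
  \sum_e N a b e * N e c d = \sum_e N b c e * N a e d.
Proof.
rewrite -hdim_tensorl -hdim_tensorr.
by apply: hdim_iso (isomorphic_refl _) _; constructor; exact: assoc.
Qed.

(** Self-duality turns [hdim_duality_le] into an inequality between structure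
constants that is its own converse after exchanging [b] and [c]. *)
Lemma fusion_coefC23 a b c : N a b c = N a c b.
Proof.
have le b' c' : N a b' c' <= N a c' b'.
  rewrite /fusion_coef -(hdim_irr_sym (fus_semisimple C) t_irr).
  have sim_a : simple 't_a by case: t_irr.
  have dual_a : ldual 't_a ⊗ 't_b' ≅ 't_a ⊗ 't_b'.
    exact: tensor_iso (C_self_dual sim_a) (isomorphic_refl _).
  rewrite -(hdim_iso dual_a (isomorphic_refl _)).
  exact: hdim_duality_le (ldualP _).
by apply/eqP; rewrite eqn_leq !le.
Qed.

(** Since [N e c u] is 1 for [e = c] and 0 otherwise, taking [d = u] in
the associativity identity leaves one term on each side. *)
Lemma fusion_coef_cycle a b c : N a b c = N b c a.
Proof.
have := fusion_coef_assoc a b c u.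
under eq_bigr do rewrite [N _ c u]fusion_coefC23 fusion_coef_unitr.
under [RHS]eq_bigr do rewrite [N a _ u]fusion_coefC23 fusion_coef_unitr.
rewrite (bigD1 c) //= eqxx muln1 big1 ?addn0; last first.
  by move=> i /negPf ->; rewrite muln0.
rewrite (bigD1 a) //= eqxx muln1 big1 ?addn0 // => i.
by rewrite eq_sym => /negPf ->; rewrite muln0.
Qed.

Lemma fusion_coefC a b c : N a b c = N b a c.
Proof. by rewrite fusion_coef_cycle fusion_coefC23. Qed.

(** If [W] is inverse to [t_a], then [t_a] occurs in [W], because [N a e u] is 0
for [e] different from [a] while the unit occurs in [t_a ⊗ W]. Hence
[t_a ⊗ t_a] is a summand of [t_a ⊗ W], that is, of the unit. *)
Lemma invertible_square a : invertible 't_a -> 't_a ⊗ 't_a ≅ \1.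
Proof.
case=> W [aW _]; rewrite -t_unit; rewrite -t_unit in aW.
pose w e := hdim 't_e W.
have wP c : \sum_e w e * N a e c = (c == u).
  rewrite -hdim_tensorr -(hdim_irr (fus_semisimple C) t_irr).
  exact: hdim_iso (isomorphic_refl _) aW.
have wa : w a = 1.
  have := wP u; rewrite eqxx (bigD1 a) //= fusion_coefC23 fusion_coef_unitr eqxx.
  rewrite big1 ?addn0 ?muln1 // => e ea.
  by rewrite fusion_coefC23 fusion_coef_unitr eq_sym (negPf ea) muln0.
apply: (isomorphic_hdim (fus_semisimple C) t_irr) => c.
rewrite (hdim_irr (fus_semisimple C) t_irr) -/(N a a c).
case: (eqVneq c u) => [->|cu].
  by rewrite fusion_coefC23 fusion_coef_unitr eqxx.
by have := wP c; rewrite (negPf cu) (bigD1 a) //= wa mul1n; case: (N a a c).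
Qed.

End FusionRules.

(** * Rank four *)

Local Notation i0 := (@Ordinal 4 0 isT).
Local Notation i1 := (@Ordinal 4 1 isT).
Local Notation i2 := (@Ordinal 4 2 isT).
Local Notation i3 := (@Ordinal 4 3 isT).

Lemma sum_ord4 (F : 'I_4 -> nat) : \sum_e F e = F i0 + F i1 + F i2 + F i3.
Proof.
rewrite !big_ord_recr big_ord0 /= add0n.
by congr (F _ + F _ + F _ + F _); exact: val_inj.
Qed.

Lemma forall_ord4 (P : 'I_4 -> Prop) :
  P i0 -> P i1 -> P i2 -> P i3 -> forall i, P i.
Proof.
by move=> P0 P1 P2 P3 [[|[|[|[|//]]]] i_lt]; rewrite (bool_irrelevance i_lt isT).
Qed.

Theorem proposition3p2 (k : closedFieldType) (char0 : [pchar k]%R =i pred0)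
    (C : fusionCategory k) (C_self_dual : self_dual C) (C_rank : has_rank C 4)
    (g X Y : C) (C_Irr : enumerates_Irr [tuple \1; g; X; Y])
    (C_pt : forall V : C, simple V -> (invertible V <-> V ≅ \1 \/ V ≅ g))
    (fixed_point : exists V : C, [/\ simple V, ~ invertible V & g ⊗ V ≅ V]) :
  exists m n s t : nat,
    [/\ g ⊗ g ≅ \1, g ⊗ X ≅ X, g ⊗ Y ≅ Y & Y ⊗ X ≅ n · X ⊕ s · Y] /\
    [/\ X ⊗ X ≅ \1 ⊕ g ⊕ m · X ⊕ n · Y & Y ⊗ Y ≅ \1 ⊕ g ⊕ s · X ⊕ t · Y] /\
    (* the products obtained from the above by commutativity *)
    [/\ X ⊗ g ≅ X, Y ⊗ g ≅ Y & X ⊗ Y ≅ n · X ⊕ s · Y] /\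
    n ^ 2 + s ^ 2 = 2 + m * s + n * t.
Proof.
have ssC := fus_semisimple C.
pose t4 := [tuple \1; g; X; Y] : 4.-tuple C.
have unit4 : tnth t4 i0 = \1 by [].
pose N := fusion_coef t4.
have gg1 : g ⊗ g ≅ \1.
  apply: (invertible_square C_self_dual C_Irr unit4 (a := i1)).
  have [sim _ _] := C_Irr; apply/(C_pt _ (sim i1)); right.
  exact: isomorphic_refl.
have N1l b c : N i0 b c = (b == c) := fusion_coef_unitl C_Irr unit4 b c.
have NC a b c : N a b c = N b a c := fusion_coefC C_self_dual C_Irr unit4 a b c.
have NC23 a b c : N a b c = N a c b := fusion_coefC23 C_self_dual C_Irr a b c.
have NA a b c d : \sum_e N a b e * N e c d = \sum_e N b c e * N a e d.
  exact: fusion_coef_assoc C_Irr a b c d.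
have N0 a b : N a b i0 = (a == b) by rewrite NC23 NC N1l.
have Ngg c : N i1 i1 c = (c == i0).
  rewrite -(hdim_irr ssC C_Irr).
  exact: hdim_iso (isomorphic_refl _) gg1.
have Ng1 a : N i1 a i1 = (a == i0) by rewrite NC23 Ngg.
have fixXY : N i1 i2 i2 = 1 \/ N i1 i3 i3 = 1.
  have [V [simV invV gV]] := fixed_point.
  have fixN i : V ≅ tnth t4 i -> N i1 i i = 1.
    move=> Vi; transitivity (hdim V V); last exact: hdim_simple_self.
    apply: hdim_iso; first exact: isomorphic_sym.
    apply: isomorphic_trans gV; apply: tensor_iso (isomorphic_refl _) _.
    exact: isomorphic_sym.
  have [_ _ /(_ V simV)[i]] := C_Irr; elim/forall_ord4: i => Vi.
  - by case: invV; apply/(C_pt _ simV); left.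
  - by case: invV; apply/(C_pt _ simV); right.
  - by left; exact: fixN.
  - by right; exact: fixN.
(* The diagonal entries of the square of the action of [g] on the span of [X]
   and [Y], which is the identity. *)
have [NgX NgXY NgY] : [/\ N i1 i2 i2 = 1, N i1 i2 i3 = 0 & N i1 i3 i3 = 1].
  have := NA i1 i1 i2 i2; have := NA i1 i1 i3 i3.
  rewrite !sum_ord4 !N0 !Ng1 !Ngg !N1l [N i1 i3 i2]NC23 /= => ? ?.
  by case: fixXY => ?; split; nia.
pose m := N i2 i2 i2; pose n := N i2 i2 i3; pose s := N i2 i3 i3.
pose r := N i3 i3 i3.
have gX c : N i1 i2 c = (c == i2).
  by elim/forall_ord4: c; rewrite ?N0 ?Ng1 ?NgX ?NgXY.
have gY c : N i1 i3 c = (c == i3).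
  by elim/forall_ord4: c; rewrite ?N0 ?Ng1 ?NgY // NC23 NgXY.
have XX c : N i2 i2 c = (c == i0) + (c == i1) + m * (c == i2) + n * (c == i3).
  elim/forall_ord4: c; rewrite ?N0 ?[N _ _ i1]NC23 ?(NC i2 i1) ?gX /=; lia.
have XY c : N i2 i3 c = n * (c == i2) + s * (c == i3).
  elim/forall_ord4: c; rewrite ?N0 ?[N _ _ i1]NC23 ?(NC i2 i1) ?gX ?(NC23 i2 i3 i2) /=; lia.
have YY c : N i3 i3 c = (c == i0) + (c == i1) + s * (c == i2) + r * (c == i3).
  elim/forall_ord4: c; rewrite ?N0 ?[N _ _ i1]NC23 ?(NC i3 i1) ?gY /=; last lia.
  - lia.
  - lia.
  - rewrite NC23 NC -/s; lia.
have hdimE a c : hdim (tnth t4 c) (tnth t4 a) = (c == a) := hdim_irr ssC C_Irr c a.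
have isoP a b V : (forall c, N a b c = hdim (tnth t4 c) V) ->
    tnth t4 a ⊗ tnth t4 b ≅ V.
  exact: (isomorphic_hdim ssC C_Irr).
have hdim1 := hdimE i0; have hdimg := hdimE i1.
have hdimX := hdimE i2; have hdimY := hdimE i3.
rewrite /= in hdim1 hdimg hdimX hdimY.
exists m, n, s, r; split; [split|split; [split|split; [split|]]].
- exact: gg1.
- by apply: (isoP i1 i2) => c; rewrite gX hdimX.
- by apply: (isoP i1 i3) => c; rewrite gY hdimY.
- by apply: (isoP i3 i2) => c; rewrite NC XY hdim_dsum !hdim_muln hdimX hdimY.
- apply: (isoP i2 i2) => c.
  by rewrite XX !hdim_dsum !hdim_muln hdim1 hdimg hdimX hdimY.
- apply: (isoP i3 i3) => c.
  by rewrite YY !hdim_dsum !hdim_muln hdim1 hdimg hdimX hdimY.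
- by apply: (isoP i2 i1) => c; rewrite NC gX hdimX.
- by apply: (isoP i3 i1) => c; rewrite NC gY hdimY.
- by apply: (isoP i2 i3) => c; rewrite XY hdim_dsum !hdim_muln hdimX hdimY.
(* The multiplicity of [Y] in the two bracketings of [X ⊗ X ⊗ Y]. *)
have := NA i2 i2 i3 i3; rewrite !sum_ord4 !XX !XY N1l gY YY /=.
nia.
Qed.
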